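(* For every integer $n\ge 2$, $\operatorname{TC}^S_n(S^1)=2(n-1)$.
   Context: The Schwarz genus of a map $p:E\to B$, denoted $\mathrm{genus}(p)$, is the least $k$ such that there is an open cover $U_0,\ldots,U_k$ of $B$ and, for each $i$, a continuous map $s_i:U_i\to E$ with $ps_i$ homotopic to the inclusion $U_i\hookrightarrow B$ (for a fibration, equivalently, honest local sections). For $i\ge 2$ let $J_i$ be the wedge of $i$ copies of $[0,1]$, each with base point $0$, and let $1_j$ denote the point $1$ in the $j$-th copy. Let $X^{J_i}$ be the space of continuous maps $J_i\to X$ (compact-open topology), and $e_i:X^{J_i}\to X^i$, $e_i(\gamma)=(\gamma(1_1),\ldots,\gamma(1_i))$. The symmetric group $\Sigma_i$ acts on $X^i$ by permuting coordinates and on $X^{J_i}$ by correspondingly permuting the $i$ paths, making $e_i$ equivariant. Let $\mathrm{Conf}_i(X)\subset X^i$ be the space of $i$-tuples of pairwise distinct points, $\mathrm{Braid}_i(X)=\mathrm{Conf}_i(X)/\Sigma_i$, and $Y_i(X)=e_i^{-1}(\mathrm{Conf}_i(X))/\Sigma_i$. The map $e_i$ induces a fibration $\varepsilon_i=\varepsilon_i^X:Y_i(X)\to\mathrm{Braid}_i(X)$. For $n\ge 2$, $\operatorname{TC}_n^S(X)=\mathrm{genus}(\varepsilon_n^X)+\mathrm{genus}(\varepsilon_{n-1}^X)+\cdots+\mathrm{genus}(\varepsilon_2^X)+n-1$. *)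

(* Defs.v *)
From HB Require Import structures.
From mathcomp Require Import all_boot all_order all_algebra fingroup perm.
From mathcomp Require Import generic_quotient.
From mathcomp Require Import all_classical all_reals all_analysis homotopy.
Export numFieldNormedType.Exports.

Set Implicit Arguments.
Unset Strict Implicit.
Unset Printing Implicit Defensive.

Import Order.TTheory GRing.Theory Num.Theory.
Local Open Scope classical_set_scope.
Local Open Scope ring_scope.
Local Open Scope quotient_scope.

Section Defs.
Variable R : realType.

Definition unit_interval : topologicalType := set_type `[0 : R, 1]%classic.

Lemma unit_interval_in (x : R) : 0 <= x <= 1 -> x \in `[0 : R, 1]%classic.
Proof. by move=> x01; apply/mem_set; rewrite /= in_itv. Qed.

Definition interval0 : unit_interval :=
  exist _ 0 (unit_interval_in (introT andP (conj (lexx 0) ler01))).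
Definition interval1 : unit_interval :=
  exist _ 1 (unit_interval_in (introT andP (conj ler01 (lexx 1)))).

Definition homotopic (A B : topologicalType) (f g : A -> B) : Prop :=
  exists H : A * unit_interval -> B,
    [/\ continuous H,
        forall a, H (a, interval0) = f a &
        forall a, H (a, interval1) = g a].

Definition genus_le (E B : topologicalType) (p : E -> B) (k : nat) : Prop :=
  exists U : 'I_k.+1 -> set B,
    [/\ forall i, open (U i),
        \bigcup_i U i = [set: B] &
        forall i, exists2 s : U i -> E,
          continuous s & homotopic (p \o s) (set_val : U i -> B)].

(* The genus is +oo when no finite cover of the required kind exists. *)
Definition genus (E B : topologicalType) (p : E -> B) : \bar R :=
  ereal_inf [set (k%:R)%:E | k in [set k : nat | genus_le p k]].

Section Configurations.
Variables (i : nat) (X : topologicalType).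

Definition multipath_dom : topologicalType :=
  @wedge 'I_i (fun=> unit_interval) (fun=> interval0).

Definition multipath_lift (j : 'I_i) (t : unit_interval) : multipath_dom :=
  @wedge_lift 'I_i (fun=> unit_interval) (fun=> interval0) j t.

Definition multipath_perm (s : 'S_i) : multipath_dom -> multipath_dom :=
  wedge_fun (fun j t => multipath_lift (s j) t).

Lemma multipath_permE (s : 'S_i) j t :
  multipath_perm s (multipath_lift j t) = multipath_lift (s j) t.
Proof.
rewrite /multipath_perm /multipath_lift wedge_lift_funE// => a b.
exact: wedge_liftE.
Qed.

Lemma multipath_ext (T : Type) (f g : multipath_dom -> T) :
  (forall j t, f (multipath_lift j t) = g (multipath_lift j t)) -> f = g.
Proof.
move=> fg; apply/funext => x.
have : [set: multipath_dom] x by [].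
by rewrite /multipath_dom -wedgeTE => -[j _ [t _ <-]]; exact: fg.
Qed.

Definition multipath : Type := continuousType multipath_dom X.

HB.instance Definition _ := Choice.on multipath.
HB.instance Definition _ := Topological.copy multipath
  (@initial_topology multipath {compact-open, multipath_dom -> X}
    (fun g : continuousType multipath_dom X => g)).

Definition multipath_fun (g : multipath) : multipath_dom -> X :=
  (g : continuousType multipath_dom X).

Definition power : topologicalType := prod_topology (fun _ : 'I_i => X).

Definition endpoints (g : multipath) : power :=
  fun j => multipath_fun g (multipath_lift j interval1).

Definition conf_set : set power := [set x | injective (x : 'I_i -> X)].

Definition conf : topologicalType := set_type conf_set.

Definition econf : topologicalType := set_type (endpoints @^-1` conf_set).

Definition endpoints_conf (g : econf) : conf :=
  exist _ (endpoints (set_val g)) (mem_set (set_valP g)).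

Definition conf_rel (x y : conf) : bool :=
  `[< exists s : 'S_i,
        (set_val y : 'I_i -> X) = (set_val x : 'I_i -> X) \o s >].

Definition econf_rel (g h : econf) : bool :=
  `[< exists s : 'S_i, multipath_fun (set_val h)
        = multipath_fun (set_val g) \o multipath_perm s >].

Lemma conf_rel_equiv : equiv_class_of conf_rel.
Proof.
split=> [x|x y|y x z].
- by apply/asboolP; exists 1%g; apply/funext => j /=; rewrite perm1.
- by apply/asboolP/asboolP => -[s e]; exists (s^-1)%g; rewrite e;
    apply/funext => j /=; rewrite permKV.
- move=> /asboolP[s es] /asboolP[r er]; apply/asboolP.
  by exists (r * s)%g; rewrite er es; apply/funext => j /=; rewrite permM.
Qed.

Lemma econf_rel_equiv : equiv_class_of econf_rel.
Proof.
split=> [x|x y|y x z].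
- apply/asboolP; exists 1%g; apply: multipath_ext => j t /=.
  by rewrite multipath_permE perm1.
- by apply/asboolP/asboolP => -[s e]; exists (s^-1)%g; rewrite e;
    apply: multipath_ext => j t /=; rewrite !multipath_permE permKV.
- move=> /asboolP[s es] /asboolP[r er]; apply/asboolP.
  exists (r * s)%g; rewrite er es; apply: multipath_ext => j t /=.
  by rewrite !multipath_permE permM.
Qed.

Definition conf_equiv := EquivRelPack conf_rel_equiv.
Definition econf_equiv := EquivRelPack econf_rel_equiv.

Definition braid : Type := {eq_quot conf_equiv}.
HB.instance Definition _ := Topological.copy braid
  (quotient_topology {eq_quot conf_equiv}).
HB.instance Definition _ := Quotient.copy braid {eq_quot conf_equiv}.

Definition ebraid : Type := {eq_quot econf_equiv}.
HB.instance Definition _ := Topological.copy ebraid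
  (quotient_topology {eq_quot econf_equiv}).
HB.instance Definition _ := Quotient.copy ebraid {eq_quot econf_equiv}.

Definition epsilon (q : ebraid) : braid := \pi_braid (endpoints_conf (repr q)).

Lemma epsilonE (g : econf) :
  epsilon (\pi_ebraid g) = \pi_braid (endpoints_conf g).
Proof.
rewrite /epsilon; case: piP => h /eqmodP /asboolP[s e].
apply/eqmodP/asboolP; exists (s^-1)%g; apply/funext => j /=.
rewrite !set_valE /= /endpoints e /=.
by rewrite multipath_permE permKV.
Qed.

End Configurations.

Definition TCS (n : nat) (X : topologicalType) : \bar R :=
  ((\sum_(2 <= i < n.+1) genus (@epsilon i X)) + (n - 1)%N%:R%:E)%E.

Definition circle : topologicalType :=
  set_type [set p : R * R | p.1 ^+ 2 + p.2 ^+ 2 = 1].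

End Defs.

(* Main.v *)
Require Import Defs.
From HB Require Import structures.
From mathcomp Require Import all_boot all_order all_algebra fingroup perm.
From mathcomp Require Import generic_quotient complex ring lra.
From mathcomp Require Import all_classical all_reals all_analysis homotopy.

(* Each genus(eps_i) with i >= 2 equals 1. Let mu : Braid_i(S^1) -> S^1 be the
   product of the points of a configuration.

   Lower bound: over Y_i, the map mu o eps_i is homotopic to the i-th power of
   the common base point of the multipath (multiply the i paths together and
   shrink them). A global section up to homotopy would thus make mu homotopic
   to an i-th power, but mu has degree 1 on the loop that rotates the i-th roots
   of unity by one step.

   Upper bound: where mu avoids a given point, it has a continuous argument m.
   The points of a configuration then have a unique set of angles, consecutive
   around the circle, whose sum is m, and scaling these angles gives paths from
   1 to the points, hence a strict local section of eps_i. Two values to avoid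
   give an open cover. *)

Set Implicit Arguments.
Unset Strict Implicit.
Unset Printing Implicit Defensive.

Import Order.TTheory GRing.Theory Num.Theory.
Local Open Scope classical_set_scope.
Local Open Scope ring_scope.
Local Open Scope complex_scope.
Local Open Scope quotient_scope.

Local Notation Re := complex.Re.
Local Notation Im := complex.Im.

(** * The exponential and the argument on the unit circle *)

Section CircleLog.
Variable R : realType.
Implicit Types (t : R) (z : R[i]).

Definition cis t : R[i] := cos t +i* sin t.

Lemma cis0 : cis 0 = 1.
Proof. by rewrite /cis cos0 sin0. Qed.

Lemma cisD s t : cis (s + t) = cis s * cis t.
Proof. by rewrite /cis cosD sinD; simpc; congr (_ +i* _); ring. Qed.

Lemma norm_cis t : `|cis t| = 1.
Proof. by rewrite normc_def /= cos2Dsin2 sqrtr1. Qed.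

Lemma cis_neq0 t : cis t != 0.
Proof. by rewrite -normr_eq0 norm_cis oner_eq0. Qed.

Lemma cisN t : cis (- t) = (cis t)^-1.
Proof.
apply: (mulIf (cis_neq0 t)); rewrite mulVf ?cis_neq0 // -cisD addNr.
exact: cis0.
Qed.

Lemma cisB s t : cis (s - t) = cis s / cis t.
Proof. by rewrite cisD cisN. Qed.

Lemma cis_pi : cis pi = - 1.
Proof. by rewrite /cis cospi sinpi; simpc. Qed.

Lemma cisMn t n : cis (t *+ n) = cis t ^+ n.
Proof.
elim: n => [|n IH]; first by rewrite mulr0n cis0 expr0.
by rewrite mulrS cisD IH exprS.
Qed.

Lemma cis_sum (I : Type) (r : seq I) (P : pred I) (F : I -> R) :
  cis (\sum_(k <- r | P k) F k) = \prod_(k <- r | P k) cis (F k).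
Proof. exact: (big_morph cis cisD cis0). Qed.

Lemma norm1_sqr z : `|z| = 1 -> Re z ^+ 2 + Im z ^+ 2 = 1.
Proof.
rewrite normc_def => /(congr1 (@complex.Re R))/= z1.
by rewrite -[LHS]sqr_sqrtr ?z1 ?expr1n // addr_ge0 ?sqr_ge0.
Qed.

Lemma norm1_Re_neqN1 z : `|z| = 1 -> z != - 1 -> 1 + Re z != 0.
Proof.
move=> /norm1_sqr z1; apply: contra => z0.
have rz : Re z = -1 by lra.
move: z1; rewrite rz sqrrN expr1n => z1.
have : Im z ^+ 2 = 0 by lra.
move/eqP; rewrite sqrf_eq0 => /eqP iz.
by case: z rz iz {z0 z1} => a b /= -> ->; rewrite -[0]oppr0; apply/eqP; simpc.
Qed.

(* The half-angle formula; the value at [z = -1] is junk. *)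
Definition arg z : R := atan (Im z / (1 + Re z)) *+ 2.

(** With [x] the tangent of the half-angle [a], the double-angle formulas only require
    [sin a = x * cos a] and [cos a ^+ 2 = (1 + Re z) / 2]. *)
Lemma argK z : `|z| = 1 -> z != - 1 -> cis (arg z) = z.
Proof.
move=> z1 zN1; have c0 := norm1_Re_neqN1 z1 zN1; have {}z1 := norm1_sqr z1.
rewrite /arg /cis cos_mulr2n sin_mulr2n.
set x := _ / _; set a := atan x.
have ca : cos a ^+ 2 = (1 + x ^+ 2)^-1.
  by rewrite /a cos_atan exprVn sqr_sqrtr // addr_ge0 ?sqr_ge0.
have ca0 : cos a != 0.
  rewrite -sqrf_eq0 ca invr_eq0; apply: lt0r_neq0.
  by rewrite ltr_pwDl ?sqr_ge0.
have sa : sin a = x * cos a.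
  by rewrite -[x in RHS]atanK /tan -/a mulfVK.
have {}ca : cos a ^+ 2 = (1 + Re z) / 2.
  rewrite ca; apply: (mulIf (x := 2)) => //.
  rewrite divfK //; apply: (mulfI c0).
  have -> : 1 + x ^+ 2 = 2 / (1 + Re z).
    rewrite /x expr_div_n.
    have -> : Im z ^+ 2 = 1 - Re z ^+ 2 by lra.
    by field.
  by field.
rewrite sa mulrCA -expr2 ca.
case: z @x @a z1 zN1 c0 ca ca0 sa => u v /= *; congr (_ +i* _).
  by field.
by field.
Qed.

(** Since cos t = 1 - 2 sin(t/2)^2, the value 1 forces [sin (t / 2) = 0], whereas the sine is
    positive on (0, pi). *)
Lemma cis_eq1_lt t : 0 <= t < pi *+ 2 -> cis t = 1 -> t = 0.
Proof.
move=> /andP[t0 t2] /(congr1 (@complex.Re R)) /= ct.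
have th : t = (t / 2) *+ 2 by rewrite -mulr_natr divfK.
have sh : sin (t / 2) = 0.
  move: ct; rewrite th cos_mulr2n cos2sin2 => ct.
  apply/eqP; rewrite -sqrf_eq0; apply/eqP; move: ct.
  by rewrite -th -mulr_natr; lra.
apply/eqP; rewrite eq_le t0 andbT leNgt; apply/negP => t_gt0.
suff : 0 < sin (t / 2) by rewrite sh ltxx.
apply: sin_gt0_pi; rewrite divr_gt0 //= ltr_pdivrMr //.
by rewrite mulr_natr.
Qed.

Lemma cisMz t (k : int) : cis t = 1 -> cis (t *~ k) = 1.
Proof.
move=> t1; case: k => n; rewrite ?NegzE ?mulrNz.
  by rewrite -pmulrn cisMn t1 expr1n.
by rewrite cisN -pmulrn cisMn t1 expr1n invr1.
Qed.

Lemma cis2pi : cis (pi *+ 2 : R) = 1.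
Proof. by rewrite cisMn cis_pi sqrrN expr1n. Qed.

Lemma cis_eq1 t : cis t = 1 -> exists k : int, t = (pi *+ 2) *~ k.
Proof.
move=> t1; have p0 : 0 < pi *+ 2 :> R by rewrite mulrn_wgt0 // pi_gt0.
(* Subtracting this multiple of 2 pi brings [t] into [0, 2 pi). *)
pose k := Num.floor (t / (pi *+ 2)).
exists k; apply/eqP; rewrite -subr_eq0; apply/eqP; apply: cis_eq1_lt.
  rewrite subr_ge0 ltrBlDl -[X in _ + X]mulr1z -mulrzDr.
  rewrite -[_ *~ k]mulrzl -[X in _ < X]mulrzl.
  rewrite -ler_pdivlMr // -ltr_pdivrMr //.
  by rewrite Num.Theory.floor_le Num.Theory.floorD1_gt.
by rewrite cisB t1 (cisMz _ cis2pi) divr1.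
Qed.

(** Continuity is read off the two coordinates, so only the topology of [R] enters. *)
Definition ccontinuous (T : topologicalType) (f : T -> R[i]) : Prop :=
  continuous (fun x => Re (f x)) /\ continuous (fun x => Im (f x)).

Section Continuity.
Variable T : topologicalType.
Implicit Types f g : T -> R[i].

Lemma continuous_funD (u v : T -> R) :
  continuous u -> continuous v -> continuous (fun x => u x + v x).
Proof. by move=> cu cv x; apply: cvgD; [exact: cu|exact: cv]. Qed.

Lemma continuous_funN (u : T -> R) : continuous u -> continuous (fun x => - u x).
Proof. by move=> cu x; apply: cvgN; exact: cu. Qed.

Lemma continuous_funM (u v : T -> R) :
  continuous u -> continuous v -> continuous (fun x => u x * v x).
Proof. by move=> cu cv x; apply: cvgM; [exact: cu|exact: cv]. Qed.

Lemma continuous_fun_cst (c : R) : continuous (fun _ : T => c).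
Proof. by move=> x; exact: cvg_cst. Qed.

Lemma continuous_fun_comp (S V : topologicalType) (h : S -> T) (k : T -> V) :
  continuous h -> continuous k -> continuous (fun x => k (h x)).
Proof. by move=> ch ck x; apply: continuous_comp; [exact: ch|exact: ck]. Qed.

Lemma ccontinuous_cst z : ccontinuous (fun _ : T => z).
Proof. by split => x; exact: cvg_cst. Qed.

Lemma ccontinuousM f g :
  ccontinuous f -> ccontinuous g -> ccontinuous (fun x => f x * g x).
Proof.
move=> [rf jf] [rg jg]; split.
  rewrite (_ : (fun _ => _) = fun x => Re (f x) * Re (g x) - Im (f x) * Im (g x)).
    by move=> x; apply: cvgB; apply: cvgM;
      [exact: rf|exact: rg|exact: jf|exact: jg].
  by apply/funext => x; case: (f x) (g x) => a b [].
rewrite (_ : (fun _ => _) = fun x => Re (f x) * Im (g x) + Im (f x) * Re (g x)).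
  by move=> x; apply: cvgD; apply: cvgM;
    [exact: rf|exact: jg|exact: jf|exact: rg].
by apply/funext => x; case: (f x) (g x) => a b [].
Qed.

Lemma ccontinuousN f : ccontinuous f -> ccontinuous (fun x => - f x).
Proof.
move=> [rf jf]; split.
  rewrite (_ : (fun _ => _) = fun x => - Re (f x)).
    by move=> x; apply: cvgN; exact: rf.
  by apply/funext => x; case: (f x).
rewrite (_ : (fun _ => _) = fun x => - Im (f x)).
  by move=> x; apply: cvgN; exact: jf.
by apply/funext => x; case: (f x).
Qed.

(** On the unit circle the inverse is the complex conjugate. *)
Lemma ccontinuousV f : (forall x, `|f x| = 1) ->
  ccontinuous f -> ccontinuous (fun x => (f x)^-1).
Proof.
move=> f1 [rf jf].
rewrite (_ : (fun _ => _) = fun x => (f x)^*%C); last first.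
  by apply/funext => x; rewrite invC_norm f1 expr1n invr1 mul1r.
split.
  rewrite (_ : (fun _ => _) = fun x => Re (f x)) //.
  by apply/funext => x; case: (f x).
rewrite (_ : (fun _ => _) = fun x => - Im (f x)).
  by move=> x; apply: cvgN; exact: jf.
by apply/funext => x; case: (f x).
Qed.

Lemma ccontinuous_prod (I : Type) (r : seq I) (P : pred I) (F : I -> T -> R[i]) :
  (forall k, P k -> ccontinuous (F k)) ->
  ccontinuous (fun x => \prod_(k <- r | P k) F k x).
Proof.
move=> cF; elim: r => [|k r IH].
  have -> : (fun x => \prod_(k <- [::] | P k) F k x) = fun=> 1.
    by apply/funext => x; rewrite big_nil.
  exact: ccontinuous_cst.
have -> : (fun x => \prod_(j <- k :: r | P j) F j x) = fun x =>
    (if P k then F k x else 1) * \prod_(j <- r | P j) F j x.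
  by apply/funext => x; rewrite big_cons; case: ifP; rewrite ?mul1r.
apply: ccontinuousM => //.
by case: (P k) (cF k) => [/(_ isT)//|_]; exact: ccontinuous_cst.
Qed.

Lemma continuous_sum_fun (I : Type) (r : seq I) (P : pred I) (F : I -> T -> R) :
  (forall k, P k -> continuous (F k)) ->
  continuous (fun x => \sum_(k <- r | P k) F k x).
Proof.
move=> cF; elim: r => [|k r IH].
  have -> : (fun x => \sum_(k <- [::] | P k) F k x) = fun=> 0.
    by apply/funext => x; rewrite big_nil.
  by move=> x; exact: cvg_cst.
have -> : (fun x => \sum_(j <- k :: r | P j) F j x) = fun x =>
    (if P k then F k x else 0) + \sum_(j <- r | P j) F j x.
  by apply/funext => x; rewrite big_cons; case: ifP; rewrite ?add0r.
move=> x; apply: cvgD; last exact: IH.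
by case: (P k) (cF k) => [/(_ isT)|_]; [exact|exact: cvg_cst].
Qed.

Lemma ccontinuous_cis (u : T -> R) :
  continuous u -> ccontinuous (fun x => cis (u x)).
Proof.
move=> cu; split => x; apply: continuous_comp; try exact: cu.
  exact: continuous_cos.
exact: continuous_sin.
Qed.

Lemma continuous_arg f : (forall x, `|f x| = 1) -> (forall x, f x != -1) ->
  ccontinuous f -> continuous (fun x => arg (f x)).
Proof.
move=> f1 fN1 [rf jf] x; rewrite /arg.
apply: (@continuous_comp _ _ _ (fun x => Im (f x) / (1 + Re (f x)))
  (fun v => atan v *+ 2)); last first.
  rewrite (_ : (fun _ => _) = fun v => atan v + atan v) //.
  by apply: cvgD; exact: continuous_atan.
apply: cvgM; first exact: jf.
apply: cvgV; first exact: norm1_Re_neqN1.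
by apply: cvgD; [exact: cvg_cst|exact: rf].
Qed.

Lemma ccontinuous_comp (S : topologicalType) (h : S -> T) f :
  continuous h -> ccontinuous f -> ccontinuous (fun x => f (h x)).
Proof.
move=> ch [rf jf]; split => x.
  exact: (@continuous_comp _ _ _ h (fun y => Re (f y)) x (ch x) (rf (h x))).
exact: (@continuous_comp _ _ _ h (fun y => Im (f y)) x (ch x) (jf (h x))).
Qed.

Lemma open_ccontinuous_neq f g : ccontinuous f -> ccontinuous g ->
  open [set x | f x != g x].
Proof.
move=> [rf jf] [rg jg].
have o0 (h : T -> R) : continuous h -> open [set x | h x != 0].
  move=> ch; apply: (@open_comp _ _ h [set y | y != 0]); first by move=> x _; exact: ch.
  exact: open_neq.
have -> : [set x | f x != g x] =
    setU [set x : T | Re (f x) - Re (g x) != 0] [set x | Im (f x) - Im (g x) != 0].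
  by apply/seteqP; split => x; rewrite /= eq_complex negb_and !subr_eq0 => /orP.
by apply: openU; apply: o0 => x; apply: cvgB;
  [exact: rf|exact: rg|exact: jf|exact: jg].
Qed.

End Continuity.
End CircleLog.

(** * Logarithms of homotopies *)

Section UnitInterval.
Variable R : realType.
Local Notation I := (unit_interval R).

Lemma continuous_set_type (S T : topologicalType) (A : set T) (f : S -> A) :
  continuous (fun x => set_val (f x)) -> continuous f.
Proof. by move=> cf; apply: continuous_comp_initial. Qed.

Lemma set_val_continuous (T : topologicalType) (A : set T) :
  continuous (set_val : A -> T).
Proof. exact: initial_continuous. Qed.

Lemma continuous_pair (S T U : topologicalType) (f : S -> T) (g : S -> U) :
  continuous f -> continuous g -> continuous (fun x => (f x, g x)).
Proof. by move=> cf cg x; apply: (@cvg_pair _ _ _ (nbhs x)); [exact: cf|exact: cg]. Qed.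

Lemma ext_val (T : Type) (A : set T) (x y : A) : set_val x = set_val y -> x = y.
Proof. exact: val_inj. Qed.

Lemma clamp_subproof (x : R) : 0 <= Num.max 0 (Num.min 1 x) <= 1.
Proof. by rewrite le_max lexx ge_max ler01 ge_min lexx. Qed.

(** A retraction of [R] onto the unit interval: through it compactness and connectedness pass from
    the segment of [R] to the subtype. *)
Definition clamp (x : R) : I :=
  exist _ (Num.max 0 (Num.min 1 x)) (unit_interval_in (clamp_subproof x)).

Lemma val_clamp (x : R) : 0 <= x <= 1 -> set_val (clamp x) = x.
Proof.
by move=> /andP[x0 x1]; rewrite set_valE /= (min_idPr x1) (max_idPr x0).
Qed.

Lemma unit_interval_bounds (t : I) : 0 <= set_val t <= 1.
Proof. by have := set_valP t; rewrite /= in_itv. Qed.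

Lemma clampK (t : I) : clamp (set_val t) = t.
Proof. by apply: ext_val; rewrite val_clamp // unit_interval_bounds. Qed.

Lemma clamp_continuous : continuous clamp.
Proof.
apply: continuous_set_type => x; rewrite set_valE /=.
apply: (@continuous_max R R (cst 0) (cst 1 \min id)); first exact: cvg_cst.
by apply: continuous_min; [exact: cvg_cst|exact: cvg_id].
Qed.

Lemma clamp_image : clamp @` `[0, 1] = [set: I].
Proof.
apply/seteqP; split => // t _; exists (set_val t); last exact: clampK.
by rewrite /= in_itv /= unit_interval_bounds.
Qed.

Lemma unit_interval_compact : compact [set: I].
Proof.
rewrite -clamp_image; apply: continuous_compact; last exact: segment_compact.
exact/continuous_subspaceT/clamp_continuous.
Qed.

Lemma unit_interval_connected : connected [set: I].
Proof.
rewrite -clamp_image; apply: connected_continuous_connected.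
  exact: segment_connected.
exact/continuous_subspaceT/clamp_continuous.
Qed.

Lemma unit_interval_locally_compact : locally_compact [set: I].
Proof.
move=> t _; exists setT; first exact: filterT.
by split; [exact: unit_interval_compact|exact: closedT].
Qed.

Lemma unit_interval_regular : regular_space I.
Proof. exact: (@uniform_regular (set_type `[0 : R, 1]%classic)). Qed.

Lemma continuous_prod_topology (S : topologicalType) (J : Type)
    (K : J -> topologicalType) (f : S -> prod_topology K) :
  (forall j, continuous (fun x => f x j)) -> continuous f.
Proof.
move=> cf x; apply/cvg_sup => j.
exact: (@continuous_comp_initial _ S (K j) (@proj J K j) f (cf j)).
Qed.

(** The values of [h] lie in one coset of 2 pi Z, and by connectedness they form an interval, hence
    a single point. *)
Lemma cis_const (h : I -> R) : continuous h ->
  (forall t, cis (h t) = cis (h (interval0 R))) -> h (interval1 R) = h (interval0 R).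
Proof.
move=> ch hc; apply: contrapT => /eqP hn.
have /connected_intervalP itv : connected (h @` [set: I]).
  apply: connected_continuous_connected; first exact: unit_interval_connected.
  exact/continuous_subspaceT.
have gap (a b : I) : h a < h b -> False.
  move=> ab; have p0 := pi_gt0 R.
  (* Capping at [h a + pi] puts [v - h a] strictly between 0 and 2 pi, where [cis] never equals
     1. *)
  pose v := Num.min (h b) (h a + pi).
  have [c _ hcv] : (h @` [set: I]) v.
    apply: (itv (h a) (h b)); [by exists a|by exists b|].
    by rewrite /v le_min ltW //= lerDl ltW //= ge_min lexx.
  have : cis (v - h a) = 1 by rewrite -hcv cisB !hc divff // cis_neq0.
  move/cis_eq1_lt => v0; have /v0/eqP : 0 <= v - h a < pi *+ 2.
    rewrite subr_ge0 ltrBlDl /v le_min ltW //= lerDl ltW //=.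
    by rewrite gt_min ltrD2l mulr2n ltrDl p0 orbT.
  by rewrite subr_eq0 /v minEle; case: ifP => _; [rewrite gt_eqF|rewrite gt_eqF // ltrDl].
by move: hn; rewrite neq_lt => /orP[/gap|/gap].
Qed.

(* The times [u] at which [G (_, u) / G (_, 0)] has a continuous logarithm form
   an open and closed set, because [G] is never antipodal at nearby times. The
   last clause makes [theta] descend to loops. *)
Lemma homotopy_log (T : topologicalType) (G : T * I -> R[i]) :
  compact [set: T] -> ccontinuous G -> (forall p, `|G p| = 1) ->
  exists theta : T -> R, [/\ continuous theta,
    forall t, G (t, interval1 R) = G (t, interval0 R) * cis (theta t) &
    forall t t', (forall u, G (t, u) = G (t', u)) -> theta t = theta t'].
Proof.
move=> cT cG G1.
pose A := [set u : I | exists theta : T -> R, [/\ continuous theta,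
    forall t, G (t, u) = G (t, interval0 R) * cis (theta t) &
    forall t t', (forall u, G (t, u) = G (t', u)) -> theta t = theta t']].
have cGu u : ccontinuous (fun t => G (t, u)).
  apply: (@ccontinuous_comp _ _ _ (fun t => (t, u))) cG.
  by apply: continuous_pair => t; [exact: cvg_id|exact: cvg_cst].
have G0 p : G p != 0 by rewrite -normr_eq0 G1 oner_eq0.
(* The quotient avoids -1, so its [arg] is continuous and carries the logarithm from time [u] to
   time [v]. *)
have step u v : (forall t, G (t, u) != - G (t, v)) -> A u -> A v.
  move=> uv [theta [ct tE tc]].
  exists (fun t => theta t + arg (G (t, v) / G (t, u))).
  have n1 t : `|G (t, v) / G (t, u)| = 1 by rewrite normf_div !G1 divr1.
  have nN1 t : G (t, v) / G (t, u) != -1.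
    apply: contra (uv t) => /eqP e; apply/eqP.
    by rewrite -[G (t, v)](divfK (G0 (t, u))) e mulN1r opprK.
  split.
  - move=> t; apply: cvgD; first exact: ct.
    apply: continuous_arg => //; apply: ccontinuousM; first exact: cGu.
    by apply: ccontinuousV => //; exact: cGu.
  - by move=> t; rewrite cisD argK // mulrA -tE mulrC divfK.
  - by move=> t t' e; rewrite (tc _ _ e) !e.
(* Compactness of [T] gives one neighbourhood of [u] that serves all [t]. *)
have close u : \forall v \near u, forall t, G (t, u) != - G (t, v).
  move/compact_near_coveringP : cT => /(_ I (nbhs u)
     (fun v t => G (t, u) != - G (t, v)) _) near_cov.
  suff : \forall v \near u, [set: T] `<=` [set t | G (t, u) != - G (t, v)].
    by apply: filterS => v + t; exact.
  apply: near_cov => t _.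
  have oS : open [set p : T * I | G (p.1, u) != - G p].
    apply: open_ccontinuous_neq; last exact: ccontinuousN.
    by apply: ccontinuous_comp (cGu u) => p; exact: cvg_fst.
  have : nbhs (t, u) [set p : T * I | G (p.1, u) != - G p].
    by apply: open_nbhs_nbhs; split; rewrite //= -addr_eq0 -mulr2n mulrn_eq0 /=.
  case=> -[P Q] /= [Pt Qu] PQ; exists (P, Q) => // -[a b] [/= Pa Qb].
  exact: (PQ (a, b)).
have oA : open A.
  rewrite openE => u Au; near=> v; apply: (step u) => //.
  by near: v; exact: close.
have oA' : open (~` A).
  rewrite openE => u Au; near=> v => Av; apply: Au; apply: (step v) => // t.
  have uv : forall t, G (t, u) != - G (t, v) by near: v; exact: close.
  by rewrite eq_sym eqr_oppLR.
suff AT : A = [set: I] by have : A (interval1 R) by rewrite AT.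
apply: unit_interval_connected.
- exists (interval0 R), (fun=> 0); split => //; first by move=> t; exact: cvg_cst.
  by move=> t; rewrite cis0 mulr1.
- by exists A => //; rewrite setTI.
- by exists A; rewrite ?setTI // -[A]setCK; exact: open_closedC.
Unshelve. all: by end_near. Qed.

(** The homotopy [f (t * u)] joins the constant at the start of the path to [f]; its logarithm is
    the required one. *)
Lemma log_path (f : I -> R[i]) : ccontinuous f -> (forall t, `|f t| = 1) ->
  exists2 phi : I -> R, continuous phi & forall t, f t = f (interval0 R) * cis (phi t).
Proof.
move=> cf f1.
pose m (p : I * I) := clamp (set_val p.1 * set_val p.2 : R).
have cm : continuous m.
  apply: (continuous_fun_comp _ clamp_continuous).
  by apply: continuous_funM; apply: (continuous_fun_comp _ (@set_val_continuous _ _)) => p;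
    [exact: cvg_fst|exact: cvg_snd].
have [||phi [cphi fE _]] := @homotopy_log I (fun p => f (m p)) unit_interval_compact.
- exact: ccontinuous_comp.
- by move=> p; exact: f1.
exists phi => // t.
have m1 : m (t, interval1 R) = t.
  by apply: ext_val; rewrite /m /= mulr1 clampK.
have m0 : m (t, interval0 R) = interval0 R.
  by apply: ext_val; rewrite /m /= mulr0 val_clamp ?lexx ?ler01.
by move: (fE t); rewrite m1 m0.
Qed.

End UnitInterval.

(** * Quotient maps times a locally compact factor *)

Section ProdQuotient.
Import ArrowAsCompactOpen.

(* Currying turns the problem into the universal property of [q] itself. *)
Lemma continuous_prod_quotient (S Z V : topologicalType) (Q : topologicalType)
    (q : S -> Q) (f : Q * V -> Z) :
  locally_compact [set: V] -> regular_space V ->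
  (forall O : set Q, open (q @^-1` O) -> open O) -> (forall y, exists x, q x = y) ->
  continuous (fun p : S * V => f (q p.1, p.2)) -> continuous f.
Proof.
move=> lcV rV qO q_surj /continuous_curry [cf1 cf2].
rewrite -[f]curryK; apply: continuous_uncurry_regular => //.
  apply/continuousP => O oO; apply: qO.
  by move/continuousP: cf1 => /(_ _ oO).
by move=> y; have [x <-] := q_surj y; exact: cf2.
Qed.

End ProdQuotient.

(** * Invariants of configurations and multipaths on the circle *)

Section Circle.
Variable R : realType.
Local Notation I := (unit_interval R).
Local Notation S1 := (circle R).

Definition circle_val (p : S1) : R[i] := (set_val p).1 +i* (set_val p).2.

Lemma norm_circle_val p : `|circle_val p| = 1.
Proof. by have /= e := set_valP p; rewrite normc_def /= e sqrtr1. Qed.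

Lemma circle_val_neq0 p : circle_val p != 0.
Proof. by rewrite -normr_eq0 norm_circle_val oner_eq0. Qed.

Lemma circle_val_inj : injective circle_val.
Proof.
move=> p q [e1 e2]; apply: ext_val.
by rewrite [LHS]surjective_pairing [RHS]surjective_pairing e1 e2.
Qed.

Lemma ccontinuous_circle_val : ccontinuous circle_val.
Proof.
split => p /=.
  apply: (@continuous_comp _ _ _ (set_val : S1 -> R * R) fst).
    exact: set_val_continuous.
  exact: cvg_fst.
apply: (@continuous_comp _ _ _ (set_val : S1 -> R * R) snd).
  exact: set_val_continuous.
exact: cvg_snd.
Qed.

Lemma circle_cis_subproof (t : R) :
  (cos t, sin t) \in [set p : R * R | p.1 ^+ 2 + p.2 ^+ 2 = 1].
Proof. by apply/mem_set; exact: cos2Dsin2. Qed.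

Definition circle_cis (t : R) : S1 := exist _ (cos t, sin t) (circle_cis_subproof t).

Lemma circle_cisE t : circle_val (circle_cis t) = cis t.
Proof. by []. Qed.

Lemma circle_cis_continuous : continuous circle_cis.
Proof.
apply: continuous_set_type; apply: continuous_pair.
  exact: continuous_cos.
exact: continuous_sin.
Qed.

Section Prod.
Variable i : nat.

Definition prod_val (x : 'I_i -> S1) : R[i] := \prod_j circle_val (x j).

Lemma norm_prod_val x : `|prod_val x| = 1.
Proof. by rewrite normr_prod big1 // => j _; exact: norm_circle_val. Qed.

Lemma prod_val_perm x (s : 'S_i) : prod_val (x \o s) = prod_val x.
Proof. by rewrite /prod_val [RHS](reindex_inj (@perm_inj _ s)). Qed.

Definition conf_prod (x : conf i S1) : R[i] := prod_val (set_val x).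

Definition braid_prod (q : braid i S1) : R[i] := conf_prod (repr q).

Lemma braid_prodE (x : conf i S1) : braid_prod (\pi_(braid i S1) x) = conf_prod x.
Proof.
rewrite /braid_prod; case: piP => y /eqmodP /asboolP[s e].
by rewrite /conf_prod e prod_val_perm.
Qed.

Lemma norm_braid_prod q : `|braid_prod q| = 1.
Proof. exact: norm_prod_val. Qed.

Lemma braid_openP (O : set (braid i S1)) :
  open O = open (\pi_(braid i S1) @^-1` O).
Proof. by []. Qed.

Lemma ebraid_openP (O : set (ebraid R i S1)) :
  open O = open (\pi_(ebraid R i S1) @^-1` O).
Proof. by []. Qed.

Lemma braid_continuous (Z : topologicalType) (f : braid i S1 -> Z) :
  continuous (f \o \pi_(braid i S1)) -> continuous f.
Proof.
by move=> /continuousP cf; apply/continuousP => O oO; rewrite braid_openP; exact: cf.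
Qed.

Lemma ebraid_continuous (Z : topologicalType) (f : ebraid R i S1 -> Z) :
  continuous (f \o \pi_(ebraid R i S1)) -> continuous f.
Proof.
by move=> /continuousP cf; apply/continuousP => O oO; rewrite ebraid_openP; exact: cf.
Qed.

Lemma braid_pi_continuous : continuous (\pi_(braid i S1) : conf i S1 -> braid i S1).
Proof. by apply/continuousP => O oO. Qed.

Lemma ebraid_pi_continuous :
  continuous (\pi_(ebraid R i S1) : econf R i S1 -> ebraid R i S1).
Proof. by apply/continuousP => O oO. Qed.

Lemma ccontinuous_conf_prod : ccontinuous conf_prod.
Proof.
apply: ccontinuous_prod => j _.
apply: ccontinuous_comp ccontinuous_circle_val => x.
apply: (@continuous_comp _ _ _ (set_val : conf i S1 -> power i S1) (fun y => y j)).
  exact: set_val_continuous.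
exact: proj_continuous.
Qed.

Lemma ccontinuous_braid_prod : ccontinuous braid_prod.
Proof.
have [cr ci] := ccontinuous_conf_prod.
by split; apply: braid_continuous; rewrite /comp; under eq_fun do rewrite braid_prodE.
Qed.

Definition path_val (g : multipath R i S1) (j : 'I_i) (t : I) : S1 :=
  multipath_fun g (multipath_lift j t).

Lemma path_val_base g j k : path_val g j (interval0 R) = path_val g k (interval0 R).
Proof.
rewrite /path_val /multipath_lift; congr (multipath_fun g _).
exact: (@wedge_liftE _ (fun=> I) (fun=> interval0 R) k (interval0 R) j (interval0 R)).
Qed.

Lemma multipath_fun_continuous (g : multipath R i S1) : continuous (multipath_fun g).
Proof. exact: (@cts_fun _ _ (g : continuousType (multipath_dom R i) S1)). Qed.

Lemma multipath_lift_continuous (j : 'I_i) :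
  continuous (multipath_lift j : I -> multipath_dom R i).
Proof. exact: (@wedge_lift_continuous 'I_i (fun=> I) (fun=> interval0 R)). Qed.

Section PathEval.
Import ArrowAsCompactOpen.

(** Evaluation is the uncurrying of the restriction to the [j]-th copy, and [I] is locally compact
    and regular. That restriction is continuous because compact sets of [I] have compact images in
    the wedge. *)
Lemma path_val_continuous (j : 'I_i) :
  continuous (fun p : multipath R i S1 * I => path_val p.1 j p.2).
Proof.
have -> : (fun p : multipath R i S1 * I => path_val p.1 j p.2) =
    uncurry (fun g t => path_val g j t) by apply/funext => -[].
apply: continuous_uncurry_regular.
- exact: unit_interval_locally_compact.
- exact: unit_interval_regular.
- move=> g; apply/compact_open_cvgP => [|K O cK oO gKO].
    by apply: fmap_filter; exact: nbhs_filter.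
  have cK' : compact (multipath_lift j @` K : set (multipath_dom R i)).
    apply: continuous_compact => //.
    exact/continuous_subspaceT/multipath_lift_continuous.
  have cg : continuous (@multipath_fun R i S1 : multipath R i S1 ->
      {compact-open, multipath_dom R i -> S1}) by exact: initial_continuous.
  have FF : Filter (@multipath_fun R i S1 h @[h --> g]).
    by apply: fmap_filter; exact: nbhs_filter.
  have := (compact_open_cvgP _ FF).1 (cg g) _ _ cK' oO.
  rewrite image_comp => /(_ gKO) near_g.
  have : nbhs g [set h : multipath R i S1 |
      multipath_fun h @` (multipath_lift j @` K) `<=` O] by exact: near_g.
  by apply: filterS => h /=; rewrite image_comp.
- move=> g t; apply: continuous_comp; first exact: multipath_lift_continuous.
  exact: multipath_fun_continuous.
Qed.

End PathEval.

(** The homotopy on Y_i from the [i]-th power of the base point, at time 0, to mu after [epsilon],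
    at time 1. *)
Definition ebraid_prod (p : ebraid R i S1 * I) : R[i] :=
  prod_val (fun j => path_val (set_val (repr p.1)) j p.2).

Lemma ebraid_prodE (g : econf R i S1) t :
  ebraid_prod (\pi_(ebraid R i S1) g, t) = prod_val (fun j => path_val (set_val g) j t).
Proof.
rewrite /ebraid_prod [(_, _).1]/= [(_, _).2]/=; case: piP => h /eqmodP /asboolP[s e].
rewrite -[RHS](prod_val_perm _ s); congr prod_val; apply/funext => j.
by rewrite /comp /path_val e /comp multipath_permE.
Qed.

Lemma norm_ebraid_prod p : `|ebraid_prod p| = 1.
Proof. exact: norm_prod_val. Qed.

Lemma ebraid_prod1 y : ebraid_prod (y, interval1 R) = braid_prod (epsilon y).
Proof. by rewrite -[y]reprK ebraid_prodE epsilonE braid_prodE. Qed.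

Lemma ccontinuous_ebraid_prod : ccontinuous ebraid_prod.
Proof.
have [cr ci] : ccontinuous (fun p : econf R i S1 * I =>
    ebraid_prod (\pi_(ebraid R i S1) p.1, p.2)).
  have -> : (fun p : econf R i S1 * I => ebraid_prod (\pi_(ebraid R i S1) p.1, p.2)) =
      fun p => prod_val (fun j => path_val (set_val p.1) j p.2).
    by apply/funext => p; rewrite ebraid_prodE.
  apply: ccontinuous_prod => j _.
  apply: ccontinuous_comp ccontinuous_circle_val.
  move=> p; apply: (@continuous_comp _ _ _
     (fun p : econf R i S1 * I => (set_val p.1, p.2))
     (fun p : multipath R i S1 * I => path_val p.1 j p.2)).
    apply: continuous_pair => {}p; last exact: cvg_snd.
    apply: (@continuous_comp _ _ _ fst (set_val : econf R i S1 -> _)).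
      exact: cvg_fst.
    exact: set_val_continuous.
  exact: path_val_continuous.
have surj y : exists g, \pi_(ebraid R i S1) g = y by exists (repr y); rewrite reprK.
by split; apply: (continuous_prod_quotient (q := \pi_(ebraid R i S1))) => //;
  [exact: unit_interval_locally_compact|exact: unit_interval_regular|
   exact: unit_interval_locally_compact|exact: unit_interval_regular].
Qed.

End Prod.
End Circle.

(** * Lower bound *)

Section LowerBound.
Variables (R : realType) (i : nat).
Hypothesis i_gt1 : (1 < i)%N.
Local Notation I := (unit_interval R).
Local Notation S1 := (circle R).

Let i_gt0 : (0 < i)%N. Proof. exact: ltnW. Qed.
Let j0 : 'I_i := Ordinal i_gt0.

(** The paths of a multipath share their starting point, so the choice of [j0] does not affect the
    value. *)
Definition ebraid_base (y : ebraid R i S1) : R[i] :=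
  circle_val (path_val (set_val (repr y)) j0 (interval0 R)).

Lemma ebraid_baseE (g : econf R i S1) :
  ebraid_base (\pi_(ebraid R i S1) g) = circle_val (path_val (set_val g) j0 (interval0 R)).
Proof.
rewrite /ebraid_base; case: piP => h /eqmodP /asboolP[s e]; congr circle_val.
by rewrite [RHS](path_val_base _ _ (s j0)) /path_val e /comp multipath_permE.
Qed.

Lemma norm_ebraid_base y : `|ebraid_base y| = 1.
Proof. exact: norm_circle_val. Qed.

Lemma ccontinuous_ebraid_base : ccontinuous ebraid_base.
Proof.
have [cr ci] : ccontinuous (fun g : econf R i S1 => ebraid_base (\pi_(ebraid R i S1) g)).
  have -> : (fun g => ebraid_base (\pi_(ebraid R i S1) g)) =
      fun g => circle_val (path_val (set_val g) j0 (interval0 R)).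
    by apply/funext => g; rewrite ebraid_baseE.
  apply: ccontinuous_comp (@ccontinuous_circle_val R) => g.
  apply: (@continuous_comp _ _ _
     (fun g : econf R i S1 => (set_val g, interval0 R))
     (fun p : multipath R i S1 * I => path_val p.1 j0 p.2)).
    apply: continuous_pair; first exact: set_val_continuous.
    exact: (@cst_continuous (econf R i S1) I (interval0 R)).
  exact: path_val_continuous.
by split; exact: ebraid_continuous.
Qed.

Lemma ebraid_prod0 y : ebraid_prod (y, interval0 R) = ebraid_base y ^+ i.
Proof.
rewrite /ebraid_prod /prod_val (eq_bigr (fun=> ebraid_base y)).
  by rewrite prodr_const card_ord.
by move=> j _; rewrite (path_val_base _ _ j0).
Qed.

Definition rot_angle (n : nat) : R := (pi *+ 2) * n%:R / i%:R.

Lemma cis_rot_angle_mod n : cis (rot_angle (n %% i)) = cis (rot_angle n).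
Proof.
rewrite {2}(divn_eq n i) /rot_angle natrD natrM mulrDr mulrDl cisD.
rewrite mulrA mulfK ?pnatr_eq0 -?lt0n // [_ * (n %/ i)%:R]mulr_natr.
by rewrite cisMn cis2pi expr1n mul1r.
Qed.

Lemma cis_rot_angle_inj : injective (fun j : 'I_i => cis (rot_angle j)).
Proof.
have ir : 0 < i%:R :> R by rewrite ltr0n.
have p0 : 0 < pi *+ 2 :> R by rewrite mulrn_wgt0 // pi_gt0.
suff lt (j k : 'I_i) : cis (rot_angle j) = cis (rot_angle k) -> (j <= k)%N -> j = k.
  move=> j k /= e; have [jk|/ltnW kj] := leqP j k; first exact: lt.
  by apply/esym/lt.
move=> e jk; have : cis (rot_angle k - rot_angle j) = 1.
  by rewrite cisB e divff // cis_neq0.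
rewrite /rot_angle -mulrBl -mulrBr -natrB // => /cis_eq1_lt k0.
have /k0/eqP : 0 <= ((pi : R) *+ 2) * (k - j)%:R / i%:R < pi *+ 2.
  rewrite !mulr_ge0 ?invr_ge0 ?ler0n ?(ltW p0) //= ltr_pdivrMr //.
  by rewrite ltr_pM2l // ltr_nat (leq_ltn_trans (leq_subr _ _)).
rewrite !mulf_eq0 invr_eq0 (gt_eqF p0) (gt_eqF ir) /= orbF pnatr_eq0 subn_eq0 => kj.
by apply: val_inj; apply/eqP; rewrite eqn_leq jk.
Qed.

(** The [i]-th roots of unity at time 0, turned by one step 2 pi / i as [t] reaches 1. *)
Definition rot_tuple (t : R) : 'I_i -> S1 :=
  fun j => circle_cis ((pi *+ 2) * t / i%:R + rot_angle j).

Lemma rot_tuple_inj t : injective (rot_tuple t).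
Proof.
move=> j k /(congr1 (@circle_val R)); rewrite !circle_cisE !cisD.
by move/(mulfI (cis_neq0 _))/cis_rot_angle_inj.
Qed.

Definition rot_conf (t : I) : conf i S1 :=
  exist _ (rot_tuple (set_val t) : power i S1) (mem_set (rot_tuple_inj (t := set_val t))).

Lemma rot_conf_continuous : continuous rot_conf.
Proof.
apply: continuous_set_type; apply: continuous_prod_topology => j.
apply: (continuous_fun_comp _ (@circle_cis_continuous R)).
apply: continuous_funD; last exact: continuous_fun_cst.
apply: continuous_funM; last exact: continuous_fun_cst.
by apply: continuous_funM; [exact: continuous_fun_cst|exact: set_val_continuous].
Qed.

(** One step sends each root of unity to the next, so the two ends differ by the cyclic permutation
    [ordS]. *)
Lemma rot_conf_loop :
  \pi_(braid i S1) (rot_conf (interval1 R)) = \pi_(braid i S1) (rot_conf (interval0 R)).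
Proof.
apply/esym/eqmodP/asboolP; exists (perm (@ordS_inj i)); apply/funext => j.
apply: circle_val_inj; rewrite /comp permE !circle_cisE !set_valE /=.
rewrite mulr0 mul0r add0r cis_rot_angle_mod; congr cis.
by rewrite /rot_angle -mulrDl -mulrDr -natr1 addrC.
Qed.

(** Each of the [i] points turns by 2 pi t / i, so the product turns by 2 pi t: mu has degree 1 on
    this loop. *)
Lemma conf_prod_rot_conf t :
  conf_prod (rot_conf t) = conf_prod (rot_conf (interval0 R)) * cis ((pi *+ 2) * set_val t).
Proof.
have rotE u : conf_prod (rot_conf u) =
    cis ((pi *+ 2) * set_val u) * \prod_(j < i) cis (rot_angle j).
  rewrite /conf_prod /prod_val.
  under eq_bigr do rewrite set_valE /= circle_cisE cisD.
  rewrite big_split /= prodr_const card_ord -cisMn -[_ *+ i]mulr_natr divfK //.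
  by rewrite pnatr_eq0 -lt0n.
by rewrite !rotE [set_val (interval0 R)]/= mulr0 cis0 mul1r mulrC.
Qed.

(** Two logarithms of mu along the rotation loop are compared: one grows by 2 pi, the one built from
    [s] by [i] times a multiple 2 pi d. Hence i d = 1, impossible for [i > 1]. *)
Lemma not_genus_le0 : ~ genus_le R (@epsilon R i S1) 0.
Proof.
move=> [U [_ UT sU]]; have {sU} [s cs [H [cH H0 H1]]] := sU ord0.
(* A single set that covers is the whole space, so the rotation loop lands in [U ord0]. *)
have U0 q : U ord0 q.
  have : [set: braid i S1] q by [].
  by rewrite -UT => -[k _]; rewrite (ord1 k).
pose sigma (t : I) : U ord0 :=
  exist _ (\pi_(braid i S1) (rot_conf t)) (mem_set (U0 _)).
have csigma : continuous sigma.
  apply: continuous_set_type.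
  exact: (continuous_fun_comp rot_conf_continuous (@braid_pi_continuous R i)).
have sigma01 : sigma (interval1 R) = sigma (interval0 R).
  by apply: ext_val; exact: rot_conf_loop.
have cI := @unit_interval_compact R.
(* [th1] follows [H] from mu of [epsilon] after [s] to mu on the loop itself. *)
have [||th1 [cth1 th1E th1c]] :=
    @homotopy_log R I (fun p => braid_prod (H (sigma p.1, p.2))) cI.
- apply: ccontinuous_comp (@ccontinuous_braid_prod R i).
  apply: (continuous_fun_comp _ cH).
  apply: continuous_pair; last by move=> p; exact: cvg_snd.
  by apply: (continuous_fun_comp _ csigma) => p; exact: cvg_fst.
- by move=> p; exact: norm_braid_prod.
(* [th2] follows the paths chosen by [s], from the power of the base point to mu of the
   endpoints. *)
have [||th2 [cth2 th2E th2c]] :=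
    @homotopy_log R I (fun p => ebraid_prod (s (sigma p.1), p.2)) cI.
- apply: ccontinuous_comp (@ccontinuous_ebraid_prod R i).
  apply: continuous_pair; last by move=> p; exact: cvg_snd.
  apply: (continuous_fun_comp _ cs).
  by apply: (continuous_fun_comp _ csigma) => p; exact: cvg_fst.
- by move=> p; exact: norm_ebraid_prod.
have [||phi cphi phiE] := @log_path R (fun t => ebraid_base (s (sigma t))).
- apply: ccontinuous_comp ccontinuous_ebraid_base.
  exact: continuous_fun_comp csigma cs.
- by move=> t; exact: norm_ebraid_base.
have main t : conf_prod (rot_conf t) =
    ebraid_base (s (sigma (interval0 R))) ^+ i * cis (phi t *+ i + th2 t + th1 t).
  rewrite -braid_prodE.
  have -> : \pi_(braid i S1) (rot_conf t) = set_val (sigma t) by [].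
  rewrite -H1 (th1E t) H0 /= -ebraid_prod1 (th2E t) ebraid_prod0 phiE.
  by rewrite exprMn -cisMn !cisD !mulrA.
(* Both terms are logarithms of the same function up to constant factors, so [cis (h t)], and then
   [h], is constant. *)
pose h t := (pi *+ 2) * set_val t - (phi t *+ i + th2 t + th1 t).
have ch : continuous h.
  apply: continuous_funD.
    by apply: continuous_funM; [exact: continuous_fun_cst|exact: set_val_continuous].
  apply: continuous_funN; apply: continuous_funD => //; apply: continuous_funD => //.
  have -> : (fun t => phi t *+ i) = fun t => phi t * i%:R.
    by apply/funext => t; rewrite mulr_natr.
  by apply: continuous_funM => //; exact: continuous_fun_cst.
have c0 : conf_prod (rot_conf (interval0 R)) != 0.
  by rewrite -normr_eq0 norm_prod_val oner_eq0.
have hE t : cis (h t) = ebraid_base (s (sigma (interval0 R))) ^+ i /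
    conf_prod (rot_conf (interval0 R)).
  rewrite /h cisB; apply: (mulIf (cis_neq0 (phi t *+ i + th2 t + th1 t))).
  rewrite divfK ?cis_neq0 // mulrAC -main conf_prod_rot_conf mulrAC divff //.
  by rewrite mul1r.
have : h (interval1 R) = h (interval0 R).
  by apply: cis_const ch _ => t; rewrite !hE.
(* The homotopies see [t] only through [sigma t], so [th1] and [th2] agree at the two ends of the
   loop. *)
rewrite /h (th1c (interval1 R) (interval0 R)); last first.
  by move=> u; rewrite [(_, _).1]/= sigma01.
rewrite (th2c (interval1 R) (interval0 R)); last first.
  by move=> u; rewrite [(_, _).1]/= sigma01.
rewrite /= mulr1 mulr0 => hh.
(* The base points trace a closed loop, so [phi] grows by a multiple of 2 pi. *)
have : cis (phi (interval1 R) - phi (interval0 R)) = 1.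
  have e : ebraid_base (s (sigma (interval0 R))) * cis (phi (interval1 R)) =
      ebraid_base (s (sigma (interval0 R))) * cis (phi (interval0 R)).
    by rewrite -!phiE sigma01.
  rewrite cisB (mulfI _ e) ?divff ?cis_neq0 //.
  by rewrite -normr_eq0 norm_ebraid_base oner_eq0.
move=> /cis_eq1 [d dE].
have : (pi *+ 2 : R) = (phi (interval1 R) - phi (interval0 R)) *+ i.
  by rewrite mulrnBl; lra.
rewrite dE -mulrzl -mulrnAl -[LHS]mul1r => /mulIf.
have p0 : pi *+ 2 != 0 :> R by rewrite mulrn_eq0 /= gt_eqF // pi_gt0.
move=> /(_ p0) /esym/eqP; rewrite -[_ *+ i]mulr_natl.
rewrite -[i%:R]/(i%:Z%:~R) -intrM -[1]/(1%:~R) eqr_int => /eqP.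
move=> /(congr1 absz); rewrite abszM absz_nat /= => /eqP.
by rewrite muln_eq1 => /andP[/eqP i1 _]; move: i_gt1; rewrite i1.
Qed.

End LowerBound.

(** * Upper bound *)

Section UpperBound.
Variables (R : realType) (i : nat).
Hypothesis i_gt0 : (0 < i)%N.
Local Notation I := (unit_interval R).
Local Notation S1 := (circle R).

(* The angle in (0, 2pi); the value at [z = 1] is junk. *)
Definition arg_pos (z : R[i]) : R := arg (- z) + pi.

Lemma arg_posK z : `|z| = 1 -> z != 1 -> cis (arg_pos z) = z.
Proof.
move=> z1 zN1; rewrite /arg_pos cisD cis_pi argK ?normrN //; last by rewrite eqr_opp.
by rewrite mulrN1 opprK.
Qed.

Lemma continuous_arg_pos (T : topologicalType) (f : T -> R[i]) :
  (forall x, `|f x| = 1) -> (forall x, f x != 1) -> ccontinuous f ->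
  continuous (fun x => arg_pos (f x)).
Proof.
move=> f1 fN1 cf; apply: continuous_funD; last exact: continuous_fun_cst.
apply: continuous_arg; last exact: ccontinuousN.
  by move=> x; rewrite normrN.
by move=> x; rewrite eqr_opp.
Qed.

Section Lift.
Variable alpha : R.
Implicit Types x : 'I_i -> S1.

(** The argument of the product in (alpha, alpha + 2 pi), cut where the product is [cis alpha]. *)
Definition prod_angle x : R := arg_pos (prod_val x / cis alpha) + alpha.

(** For distinct points, the total of the counterclockwise angles, each in (0, 2 pi), from [x j] to
    the others. *)
Definition angle_sum x (j : 'I_i) : R :=
  \sum_(k | k != j) arg_pos (circle_val (x k) / circle_val (x j)).

Definition cut_angle x j : R := (prod_angle x - angle_sum x j - pi) / i%:R.

(* If the angles [y_k] of the points are consecutive around the circle with sum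
   [prod_angle x], then [y_k - y_j] is the summand of [angle_sum x j] or that
   summand minus [2 pi], so
   [i * y_j = prod_angle x - angle_sum x j + 2 * pi * r]
   where [0 <= r < i] is the number of points before [x j]. The half-step
   [- pi] in [cut_angle] thus makes [y_j] an interior point of
   [cut_angle x j, cut_angle x j + 2 * pi], and it depends continuously on
   [x] without sorting the points. *)
Definition lift_angle x j : R :=
  cut_angle x j + arg_pos (circle_val (x j) / cis (cut_angle x j)).

Lemma prod_angleK x : prod_val x != cis alpha -> cis (prod_angle x) = prod_val x.
Proof.
move=> xa; rewrite /prod_angle cisD arg_posK ?divfK ?cis_neq0 //.
  by rewrite normf_div norm_prod_val norm_cis divr1.
by apply: contra xa => /eqP e; rewrite -[prod_val x](divfK (cis_neq0 alpha)) e mul1r.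
Qed.

Lemma norm_circle_div (p q : S1) : `|circle_val p / circle_val q| = 1.
Proof. by rewrite normf_div !norm_circle_val divr1. Qed.

Lemma circle_div_neq1 (p q : S1) : p <> q -> circle_val p / circle_val q != 1.
Proof.
move=> pq; apply/eqP => e; apply: pq; apply: circle_val_inj.
by rewrite -[circle_val p](divfK (circle_val_neq0 q)) e mul1r.
Qed.

(** The summands exponentiate to the quotients of [x k] by [x j]; the [i] factors [x j] clear the
    denominators and supply the term of index [j]. *)
Lemma cis_angle_sum x j : injective x ->
  cis (angle_sum x j) * circle_val (x j) ^+ i = prod_val x.
Proof.
move=> xI; rewrite /angle_sum cis_sum.
have -> : \prod_(k | k != j) cis (arg_pos (circle_val (x k) / circle_val (x j))) =
    \prod_(k | k != j) (circle_val (x k) / circle_val (x j)).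
  apply: eq_bigr => k kj; rewrite arg_posK //; first exact: norm_circle_div.
  by apply: circle_div_neq1 => /xI e; rewrite e eqxx in kj.
have -> : circle_val (x j) ^+ i = circle_val (x j) * \prod_(k < i | k != j) circle_val (x j).
  by rewrite -[i in LHS]card_ord -prodr_const (bigD1 j).
rewrite mulrCA -big_split /= /prod_val [RHS](bigD1 j) //=; congr (_ * _).
by apply: eq_bigr => k _; rewrite divfK // circle_val_neq0.
Qed.

(* The [i]-th power of this quotient is [-1]. *)
Lemma circle_div_cut_neq1 x j : injective x -> prod_val x != cis alpha ->
  circle_val (x j) / cis (cut_angle x j) != 1.
Proof.
move=> xI xa; apply/eqP => /(congr1 (fun z => z ^+ i)).
rewrite expr1n expr_div_n -cisMn -[_ *+ i]mulr_natr divfK ?pnatr_eq0 -?lt0n //.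
rewrite !cisB cis_pi prod_angleK // -(cis_angle_sum j xI).
have x0 : circle_val (x j) ^+ i != 0 by rewrite expf_neq0 // circle_val_neq0.
rewrite [cis _ * _]mulrC mulfK ?cis_neq0 // invrN1 mulrN1 invrN mulrN divff //.
by move/eqP; rewrite eq_sym -addr_eq0 -mulr2n pnatr_eq0.
Qed.

Lemma cis_lift_angle x j : injective x -> prod_val x != cis alpha ->
  cis (lift_angle x j) = circle_val (x j).
Proof.
move=> xI xa; rewrite /lift_angle cisD arg_posK.
- by rewrite mulrC divfK // cis_neq0.
- by rewrite normf_div norm_circle_val norm_cis divr1.
- exact: circle_div_cut_neq1.
Qed.

(** This equivariance lets the section pass to unordered configurations; the product and the sum
    over the other points ignore their order. *)
Lemma lift_angle_perm x (s : 'S_i) j : lift_angle (x \o s) j = lift_angle x (s j).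
Proof.
have e : cut_angle (x \o s) j = cut_angle x (s j).
  rewrite /cut_angle /prod_angle prod_val_perm; congr ((_ - _ - _) / _).
  rewrite /angle_sum [RHS](reindex_inj (@perm_inj _ s)) /=.
  by apply: eq_bigl => k; rewrite (inj_eq perm_inj).
by rewrite /lift_angle e.
Qed.

Section Continuity.
Variables (T : topologicalType) (x : T -> 'I_i -> S1).
Hypothesis cx : forall j, continuous (fun a => x a j).
Hypothesis x_inj : forall a, injective (x a).
Hypothesis x_dom : forall a, prod_val (x a) != cis alpha.

Let cval j : ccontinuous (fun a => circle_val (x a j)).
Proof. exact: (ccontinuous_comp (@cx j) (@ccontinuous_circle_val R)). Qed.

Lemma prod_angle_continuous : continuous (fun a => prod_angle (x a)).
Proof.
apply: continuous_funD; last exact: continuous_fun_cst.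
apply: continuous_arg_pos => [a|a|].
- by rewrite normf_div norm_prod_val norm_cis divr1.
- apply: contra (x_dom a) => /eqP e.
  by rewrite -[prod_val (x a)](divfK (cis_neq0 alpha)) e mul1r.
- apply: ccontinuousM; last exact: ccontinuous_cst.
  by apply: ccontinuous_prod => j _; exact: cval.
Qed.

Lemma angle_sum_continuous j : continuous (fun a => angle_sum (x a) j).
Proof.
apply: continuous_sum_fun => k kj; apply: continuous_arg_pos => [a|a|].
- exact: norm_circle_div.
- by apply: circle_div_neq1 => /x_inj e; rewrite e eqxx in kj.
- apply: ccontinuousM; first exact: cval.
  by apply: ccontinuousV; [move=> a; exact: norm_circle_val|exact: cval].
Qed.

(** Each [arg_pos] is taken away from 1: by [x_dom] for the product, by injectivity for the
    quotients of points, by the half-step for the cut. *)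
Lemma lift_angle_continuous j : continuous (fun a => lift_angle (x a) j).
Proof.
have cc : continuous (fun a => cut_angle (x a) j).
  apply: continuous_funM; last exact: continuous_fun_cst.
  apply: continuous_funD; last exact: continuous_fun_cst.
  apply: continuous_funD; first exact: prod_angle_continuous.
  by apply: continuous_funN; exact: angle_sum_continuous.
apply: continuous_funD => //; apply: continuous_arg_pos => [a|a|].
- by rewrite normf_div norm_circle_val norm_cis divr1.
- exact: circle_div_cut_neq1.
- apply: ccontinuousM; first exact: cval.
  by apply: ccontinuousV; [move=> a; exact: norm_cis|exact: ccontinuous_cis].
Qed.

End Continuity.
End Lift.

(** * Multipaths from 1 with prescribed angles *)

Definition coord_fun (k j : 'I_i) (t : I) : R := (set_val t : R) *+ (j == k).

Lemma coord_fun0 k j : coord_fun k j (interval0 R) = 0.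
Proof. by rewrite /coord_fun /= mul0rn. Qed.

(** A coordinate of the map that lays the copies of the interval along the axes of R^i. *)
Definition wedge_coord (k : 'I_i) : multipath_dom R i -> R :=
  wedge_fun (coord_fun k).

Lemma wedge_coordE k j t : wedge_coord k (multipath_lift j t) = coord_fun k j t.
Proof.
by rewrite /wedge_coord /multipath_lift wedge_lift_funE // => a b; rewrite !coord_fun0.
Qed.

Lemma wedge_coord_continuous k : continuous (wedge_coord k).
Proof.
apply: wedge_fun_continuous => [j|a b]; last by rewrite !coord_fun0.
rewrite /coord_fun; case: (j == k); first exact: set_val_continuous.
exact: continuous_fun_cst.
Qed.

(* Global coordinates on the wedge give the joint continuity in [y] and [w]
   without using that the wedge is compact Hausdorff. *)
Definition ray_angle (y : 'I_i -> R) (w : multipath_dom R i) : R :=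
  \sum_k wedge_coord k w * y k.

Lemma ray_angle_lift y j t : ray_angle y (multipath_lift j t) = set_val t * y j.
Proof.
rewrite /ray_angle (bigD1 j) //= wedge_coordE /coord_fun eqxx mulr1n big1 ?addr0 //.
by move=> k kj; rewrite wedge_coordE /coord_fun eq_sym (negPf kj) mulr0n mul0r.
Qed.

Definition ray_fun (y : 'I_i -> R) (w : multipath_dom R i) : S1 :=
  circle_cis (ray_angle y w).

Lemma ray_fun_jointly_continuous (T : topologicalType) (y : T -> 'I_i -> R) :
  (forall j, continuous (fun a => y a j)) ->
  continuous (fun p : T * multipath_dom R i => ray_fun (y p.1) p.2).
Proof.
move=> cy; apply: (continuous_fun_comp _ (@circle_cis_continuous R)).
apply: continuous_sum_fun => k _; apply: continuous_funM.
  by apply: (continuous_fun_comp _ (@wedge_coord_continuous k)) => p; exact: cvg_snd.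
by apply: (continuous_fun_comp _ (@cy k)) => p; exact: cvg_fst.
Qed.

Lemma ray_fun_continuous y : continuous (ray_fun y).
Proof.
apply: (continuous_fun_comp _ (@circle_cis_continuous R)).
apply: continuous_sum_fun => k _; apply: continuous_funM; last exact: continuous_fun_cst.
exact: wedge_coord_continuous.
Qed.

HB.instance Definition _ y := isContinuous.Build _ _ (ray_fun y) (@ray_fun_continuous y).

Definition ray (y : 'I_i -> R) : multipath R i S1 :=
  (ray_fun y : continuousType (multipath_dom R i) S1).

Section RayContinuous.
Import ArrowAsCompactOpen.

Lemma ray_continuous (T : topologicalType) (y : T -> 'I_i -> R) :
  (forall j, continuous (fun a => y a j)) -> continuous (fun a => ray (y a)).
Proof.
move=> cy; apply: continuous_comp_initial.
exact: (continuous_curry_fun (ray_fun_jointly_continuous cy)).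
Qed.

End RayContinuous.

Lemma endpoints_ray y : endpoints (ray y) = (fun j => circle_cis (y j)) :> ('I_i -> S1).
Proof.
apply/funext => j; rewrite /endpoints /multipath_fun /= /ray_fun ray_angle_lift.
by rewrite mul1r.
Qed.

(** * The strict local section where mu avoids [cis alpha] *)

Section LocalSection.
Variable alpha : R.

Definition good_braid : set (braid i S1) := [set q | braid_prod q != cis alpha].

Lemma open_good_braid : open good_braid.
Proof.
by apply: open_ccontinuous_neq; [exact: ccontinuous_braid_prod|exact: ccontinuous_cst].
Qed.

Definition good_conf : set (conf i S1) := [set x | conf_prod x != cis alpha].

Definition section_path (x : conf i S1) : multipath R i S1 :=
  ray (lift_angle alpha (set_val x)).

Lemma endpoints_section x : good_conf x ->
  endpoints (section_path x) = (set_val x : 'I_i -> S1).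
Proof.
move=> gx; rewrite endpoints_ray; apply/funext => j; apply: circle_val_inj.
rewrite circle_cisE cis_lift_angle //; exact: (set_valP x).
Qed.

Lemma section_conf_subproof (x : good_conf) :
  section_path (set_val x) \in @endpoints R i S1 @^-1` @conf_set i S1.
Proof.
apply/mem_set; rewrite /= endpoints_section; last exact: (set_valP x).
exact: (set_valP (set_val x)).
Qed.

Definition section_conf (x : good_conf) : econf R i S1 :=
  exist _ (section_path (set_val x)) (section_conf_subproof x).

Lemma section_conf_continuous : continuous section_conf.
Proof.
apply: continuous_set_type; apply: ray_continuous => j.
apply: (@lift_angle_continuous _ good_conf (fun x => set_val (set_val x))).
- move=> k.
  have ck : continuous (fun y : power i S1 => y k) by exact: proj_continuous.
  exact: (continuous_fun_comp (continuous_fun_comp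
    (@set_val_continuous _ good_conf) (@set_val_continuous _ (@conf_set i S1))) ck).
- by move=> x; exact: (set_valP (set_val x)).
- by move=> x; exact: (set_valP x).
Qed.

Lemma good_conf_repr (q : good_braid) : repr (set_val q) \in good_conf.
Proof. by apply/mem_set; exact: (set_valP q). Qed.

Definition local_section (q : good_braid) : ebraid R i S1 :=
  \pi_(ebraid R i S1) (section_conf (exist _ (repr (set_val q)) (good_conf_repr q))).

Lemma epsilon_local_section q : epsilon (local_section q) = set_val q.
Proof.
rewrite epsilonE -[RHS]reprK; congr (\pi_(braid i S1) _); apply: ext_val.
exact: endpoints_section (set_valP q).
Qed.

(** Reordering the points permutes the lifted angles, hence the rays, in the same way, so every
    representative gives the same class. *)
Lemma local_sectionE (q : good_braid) (x : good_conf) :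
  \pi_(braid i S1) (set_val x) = set_val q ->
  local_section q = \pi_(ebraid R i S1) (section_conf x).
Proof.
move=> xq; have : \pi_(braid i S1) (set_val x) = \pi_(braid i S1) (repr (set_val q)).
  by rewrite reprK.
move=> /eqmodP /asboolP[s e]; apply/esym/eqmodP/asboolP; exists s.
apply: multipath_ext => j t; rewrite /comp multipath_permE /multipath_fun /=.
rewrite /ray_fun !ray_angle_lift; congr (circle_cis (_ * _)).
by rewrite -lift_angle_perm -e.
Qed.

(** [good_conf] is open and saturated, so the projection restricted to it still detects open sets,
    and continuity reduces to that of [section_conf]. *)
Lemma local_section_continuous : continuous local_section.
Proof.
apply/continuousP => O oO.
pose W : set good_conf := section_conf @^-1` (\pi_(ebraid R i S1) @^-1` O).
have [A oA AW] : open W.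
  apply: open_comp; first by move=> x _; exact: section_conf_continuous.
  by apply: open_comp oO => g _; exact: ebraid_pi_continuous.
have oG : open good_conf.
  by apply: open_ccontinuous_neq; [exact: ccontinuous_conf_prod|exact: ccontinuous_cst].
have memW (x : conf i S1) (gx : good_conf x) :
    A x <-> O (\pi_(ebraid R i S1) (section_conf (exist _ x (mem_set gx)))).
  rewrite -[A x]/((set_val @^-1` A) (exist _ x (mem_set gx) : good_conf)) AW.
  by [].
(* [B] is the preimage of [O] seen in the whole braid space; it is open because it pulls back to the
   open set of points in both [A] and [good_conf]. *)
pose B : set (braid i S1) := [set q | exists x : good_conf,
  \pi_(braid i S1) (set_val x) = q /\ O (\pi_(ebraid R i S1) (section_conf x))].
exists B; last first.
  apply/seteqP; split => q /=.
    by case=> x [xq Ox]; rewrite (local_sectionE xq).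
  move=> Oq; exists (exist _ (repr (set_val q)) (good_conf_repr q)).
  by split => //; exact: reprK.
rewrite braid_openP (_ : _ @^-1` B = A `&` good_conf); first exact: openI.
apply/seteqP; split => x /=; last first.
  move=> [Ax gx]; exists (exist _ x (mem_set gx)); split => //.
  exact/memW.
case=> y [yx Oy]; have gx : good_conf x.
  by rewrite /good_conf /= -braid_prodE -yx braid_prodE; exact: (set_valP y).
split => //; apply/(memW _ gx).
have gq : \pi_(braid i S1) x \in good_braid.
  by apply/mem_set; rewrite /good_braid /= braid_prodE.
pose q : good_braid := exist _ (\pi_(braid i S1) x) gq.
by rewrite -(@local_sectionE q) // (@local_sectionE q y).
Qed.

End LocalSection.

Lemma genus_le1 : genus_le R (@epsilon R i S1) 1.
Proof.
(* The avoided values are 1 and -1; no product equals both. *)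
pose alpha (k : 'I_2) : R := pi *+ k.
exists (fun k => good_braid (alpha k)); split => [k||k].
- exact: open_good_braid.
- apply/seteqP; split => // q _.
  have [q1|qN1] := eqVneq (braid_prod q) 1.
    exists ord_max => //; rewrite /good_braid /= /alpha /= cis_pi q1.
    by rewrite -addr_eq0 -mulr2n pnatr_eq0.
  by exists ord0 => //; rewrite /good_braid /= /alpha /= mulr0n cis0.
exists (@local_section (alpha k)); first exact: local_section_continuous.
(* The section is strict, so the constant homotopy serves. *)
exists (fun p => set_val p.1); split => // [|q].
  apply: (continuous_fun_comp _ (@set_val_continuous _ _)) => p; exact: cvg_fst.
by rewrite /= epsilon_local_section.
Qed.
End UpperBound.

Lemma genus_epsilon_circle (R : realType) (i : nat) :
  (1 < i)%N -> genus R (@epsilon R i (circle R)) = 1%:E.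
Proof.
move=> i1; apply/eqP; rewrite eq_le; apply/andP; split.
  by apply: ereal_inf_lbound; exists 1%N => //; apply: genus_le1; exact: ltnW.
apply: le_ereal_inf_tmp => _ [[|k] gk <-]; last by rewrite lee_fin ler1n.
by case: (not_genus_le0 i1 gk).
Qed.

Theorem corollary5p5 (R : realType) (n : nat) (hn : (2 <= n)%N) :
  TCS R n (circle R) = ((2 * (n - 1))%N%:R)%:E.
Proof.
(* The n - 1 genera contribute 1 each, which doubles the summand n - 1. *)
rewrite /TCS big_nat (eq_bigr (fun=> 1%:E)); last first.
  by move=> i /andP[i1 _]; exact: genus_epsilon_circle.
rewrite -big_nat sumEFin sumr_const_nat -EFinD; congr _%:E.
by rewrite subSS mul2n -addnn natrD.
Qed.
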